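(* Assume that $\mathsf{PA}^\omega$ is consistent. For each of the following four properties of formulas $A\in\mathsf{Form}_{\mathsf{MA}^\omega}$, there is no recursive algorithm which decides whether a given formula $A\in\mathsf{Form}_{\mathsf{MA}^\omega}$ has this property: (1) $\mathsf{MA}^\omega\vdash A^{\mathbf F}\to A$; (2) $\mathsf{MA}^\omega\vdash A\to (A^{\mathbf F}\to\bot)\to\bot$; (3) $\mathsf{MA}^\omega\vdash (\neg A^{\mathbf F}\to\bot)\to A$; (4) $\mathsf{MA}^\omega\vdash A\to A^{\mathbf F}$.
   Context: **Types.** Generated from countably many type variables $\xi$ by $\tau,\rho::=\xi\mid\mathbb B\mid\mathbb N\mid\mathbb L(\tau)\mid\tau\to\rho\mid\tau\times\rho$ (booleans, natural numbers, lists, functions, pairs). **Terms.** Simply typed terms built by application and $\lambda$-abstraction from typed object variables (countably many for each type), the constructors $\langle\cdot,\cdot\rangle:\tau\to\rho\to\tau\times\rho$; $\mathsf{tt},\mathsf{ff}:\mathbb B$; $0:\mathbb N$; $\mathsf S:\mathbb N\to\mathbb N$; $\mathsf{nil}_\tau:\mathbb L(\tau)$; $\cdot::_\tau\cdot:\tau\to\mathbb L(\tau)\to\mathbb L(\tau)$, and the destructors $\mathsf{split}:\rho\times\sigma\to(\rho\to\sigma\to\tau)\to\tau$; $\mathsf{Cases}:\mathbb B\to\tau\to\tau\to\tau$; $\mathcal R_{\mathbb N}:\mathbb N\to\tau\to(\mathbb N\to\tau\to\tau)\to\tau$; $\mathcal R_{\mathbb L(\rho)}:\mathbb L(\rho)\to\tau\to(\rho\to\mathbb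 L(\rho)\to\tau\to\tau)\to\tau$ (for all types $\rho,\sigma,\tau$). The usual conversion rules hold: $(\lambda_x t(x))s\mapsto t(s)$, $\mathsf{split}\langle t,s\rangle f\mapsto f\,t\,s$, $\mathsf{Cases}\,\mathsf{tt}\,t\,s\mapsto t$, $\mathsf{Cases}\,\mathsf{ff}\,t\,s\mapsto s$, $\mathcal R_{\mathbb N}\,0\,a\,f\mapsto a$, $\mathcal R_{\mathbb N}(\mathsf Sn)\,a\,f\mapsto f\,n(\mathcal R_{\mathbb N}\,n\,a\,f)$, $\mathcal R_{\mathbb L(\rho)}\,\mathsf{nil}\,a\,f\mapsto a$, $\mathcal R_{\mathbb L(\rho)}(x::l)\,a\,f\mapsto f\,x\,l(\mathcal R_{\mathbb L(\rho)}\,l\,a\,f)$; a proof of a formula also counts as a proof of any formula obtained from it by converting terms inside it. Bound variables may be renamed, and substitution is capture-avoiding. **Formulas.** Formulas of $\mathsf{NA}^\omega$: atomic formulas $\mathsf{at}(t)$ for terms $t:\mathbb B$, closed under $A\to B$, $A\wedge B$, $\forall_xA$ ($x$ an object variable of any type). Formulas of $\mathsf{MA}^\omega$: the same with one additional formula $\bot$ as a further base case. Formulas of $\mathsf{HA}^\omega$ and of $\mathsf{PA}^\omega$: those of $\mathsf{NA}^\omega$ (no $\bot$) closed additionally under $A\vee B$ and $\exists_xA$. $\mathsf{Form}_{\mathsf{XA}^\omega}$ is the set of formulas of $\mathsf{XA}^\omega$. Abbreviations: $\mathbf T:=\mathsf{at}(\mathsf{tt})$, $\mathbf F:=\mathsf{at}(\mathsf{ff})$,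 $\neg A:=A\to\mathbf F$. Implication associates to the right. **Substitution for $\bot$.** $A^S$ is the result of replacing $\bot$ by the formula $S$ in $A$: $\bot^S:=S$, $\mathsf{at}(t)^S:=\mathsf{at}(t)$, $(A\circ B)^S:=A^S\circ B^S$ for $\circ\in\{\wedge,\to\}$, $(\forall_xA)^S:=\forall_xA^S$ (renaming $x$ if necessary to avoid capture). In $\neg A^{\mathbf F}$ the substitution is applied to $A$ first. **Proofs.** Natural deduction with assumption variables: introduction and elimination rules for $\to$, $\wedge$, $\forall$ (for $\forall$-introduction, $x$ must not be free in any open assumption). Axioms of $\mathsf{NA}^\omega$ (for all formulas $A$ of the system): $\mathbf T$; $\forall_b(A(\mathsf{tt})\to A(\mathsf{ff})\to A(b))$ with $b:\mathbb B$; $\forall_n(A(0)\to\forall_n(A(n)\to A(\mathsf Sn))\to A(n))$; $\forall_l(A(\mathsf{nil})\to\forall_{x,l}(A(l)\to A(x::l))\to A(l))$. $\mathsf{MA}^\omega$ adds the axiom $\bot^+:\mathbf F\to\bot$. $\mathsf{HA}^\omega$ adds to $\mathsf{NA}^\omega$ the axioms $A\to A\vee B$; $B\to A\vee B$; $A\vee B\to(A\to C)\to(B\to C)\to C$; $A(t)\to\exists_xA(x)$; $\exists_xA\to\forall_x(A\to C)\to C$ ($x$ not free in $C$). $\mathsf{PA}^\omega$ is $\mathsf{HA}^\omega$ plus $A\vee\neg A$ for all formulas $A$. $\mathsf{XA}^\omega\vdash A$ means that there is a proof of $A$ in $\mathsf{XA}^\omega$ without free assumptions. $\mathsf{PA}^\omega$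 is consistent if $\mathsf{PA}^\omega\not\vdash\mathbf F$. *)

(* Defs.v *)
From Stdlib Require Import Arith List Bool.
From Stdlib Require Cantor Fin Vector.
Import ListNotations.

Set Implicit Arguments.
Unset Strict Implicit.

Inductive ty : Type :=
| TVar (n : nat)
| TBool
| TNat
| TList (τ : ty)
| TArr (τ ρ : ty)
| TProd (τ ρ : ty).

Declare Scope ty_scope.
Delimit Scope ty_scope with ty.
Bind Scope ty_scope with ty.
Infix "⇒" := TArr (at level 55, right associativity) : ty_scope.
Infix "×" := TProd (at level 50, left associativity) : ty_scope.
Local Open Scope ty_scope.

Definition ty_eq_dec (τ ρ : ty) : {τ = ρ} + {τ <> ρ}.
Proof. decide equality; apply Nat.eq_dec. Defined.

Inductive const : ty -> Type :=
| CPair (τ ρ : ty) : const (τ ⇒ ρ ⇒ τ × ρ)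
| CTrue : const TBool
| CFalse : const TBool
| CZero : const TNat
| CSucc : const (TNat ⇒ TNat)
| CNil (τ : ty) : const (TList τ)
| CCons (τ : ty) : const (τ ⇒ TList τ ⇒ TList τ)
| CSplit (ρ σ τ : ty) : const (ρ × σ ⇒ (ρ ⇒ σ ⇒ τ) ⇒ τ)
| CCases (τ : ty) : const (TBool ⇒ τ ⇒ τ ⇒ τ)
| CRecN (τ : ty) : const (TNat ⇒ τ ⇒ (TNat ⇒ τ ⇒ τ) ⇒ τ)
| CRecL (ρ τ : ty) :
    const (TList ρ ⇒ τ ⇒ (ρ ⇒ TList ρ ⇒ τ ⇒ τ) ⇒ τ).

(** Variables are de Bruijn indices counted separately for every type: a
    binder for a variable of type [ρ] captures [Var ρ 0] and moves the other
    variables of type [ρ] up by one; variables of other types are untouched.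
    Hence every type has countably many (free) variables, and terms and
    formulas are automatically identified up to renaming of bound variables. *)
Inductive term : ty -> Type :=
| Var (τ : ty) (n : nat) : term τ
| Con (τ : ty) (c : const τ) : term τ
| App (ρ τ : ty) (t : term (ρ ⇒ τ)) (s : term ρ) : term τ
| Lam (ρ τ : ty) (t : term τ) : term (ρ ⇒ τ).

Arguments Lam ρ {τ} t.

Declare Scope term_scope.
Delimit Scope term_scope with term.
Bind Scope term_scope with term.
Notation "t · s" := (App t s) (at level 40, left associativity) : term_scope.
Local Open Scope term_scope.

Definition tt : term TBool := Con CTrue.
Definition ff : term TBool := Con CFalse.
Definition zero : term TNat := Con CZero.
Definition succ (n : term TNat) : term TNat := Con CSucc · n.
Definition nil_ (ρ : ty) : term (TList ρ) := Con (CNil ρ).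
Definition cons_ (ρ : ty) (x : term ρ) (l : term (TList ρ)) : term (TList ρ) :=
  Con (CCons ρ) · x · l.

Definition renaming : Type := ty -> nat -> nat.

Definition shift (ρ : ty) : renaming :=
  fun τ n => if ty_eq_dec ρ τ then S n else n.

Definition up_ren (ρ : ty) (r : renaming) : renaming :=
  fun τ n =>
    if ty_eq_dec ρ τ then match n with 0 => 0 | S m => S (r τ m) end
    else r τ n.

Fixpoint rename (τ : ty) (r : renaming) (t : term τ) : term τ :=
  match t with
  | Var τ n => Var τ (r τ n)
  | Con c => Con c
  | App t s => App (rename r t) (rename r s)
  | Lam ρ t => Lam ρ (rename (up_ren ρ r) t)
  end.

Definition substitution : Type := forall τ : ty, nat -> term τ.

(** [scons s σ] instantiates the variable bound by the outermost binder (of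
    type [ρ]) with [s] and applies [σ] to all variables outside that binder. *)
Definition scons (ρ : ty) (s : term ρ) (σ : substitution) : substitution :=
  fun τ n =>
    match ty_eq_dec ρ τ with
    | left e =>
        match n with 0 => eq_rect ρ term s τ e | S m => σ τ m end
    | right _ => σ τ n
    end.

Definition up (ρ : ty) (σ : substitution) : substitution :=
  scons (Var ρ 0) (fun τ n => rename (shift ρ) (σ τ n)).

Fixpoint subst (τ : ty) (σ : substitution) (t : term τ) : term τ :=
  match t with
  | Var τ n => σ τ n
  | Con c => Con c
  | App t s => App (subst σ t) (subst σ s)
  | Lam ρ t => Lam ρ (subst (up ρ σ) t)
  end.

Definition inst (ρ : ty) (s : term ρ) : substitution := scons s Var.

Inductive conv : forall τ : ty, term τ -> term τ -> Prop :=
| conv_refl τ (t : term τ) : conv t t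
| conv_sym τ (t s : term τ) : conv t s -> conv s t
| conv_trans τ (t s r : term τ) : conv t s -> conv s r -> conv t r
| conv_app ρ τ (t t' : term (ρ ⇒ τ)) (s s' : term ρ) :
    conv t t' -> conv s s' -> conv (t · s) (t' · s')
| conv_lam ρ τ (t t' : term τ) : conv t t' -> conv (Lam ρ t) (Lam ρ t')
| conv_beta ρ τ (t : term τ) (s : term ρ) :
    conv (Lam ρ t · s) (subst (inst s) t)
| conv_split ρ σ τ (t : term ρ) (s : term σ) (f : term (ρ ⇒ σ ⇒ τ)) :
    conv (Con (CSplit ρ σ τ) · (Con (CPair ρ σ) · t · s) · f) (f · t · s)
| conv_cases_tt τ (t s : term τ) : conv (Con (CCases τ) · tt · t · s) t
| conv_cases_ff τ (t s : term τ) : conv (Con (CCases τ) · ff · t · s) s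
| conv_recN_zero τ (a : term τ) (f : term (TNat ⇒ τ ⇒ τ)) :
    conv (Con (CRecN τ) · zero · a · f) a
| conv_recN_succ τ (n : term TNat) (a : term τ) (f : term (TNat ⇒ τ ⇒ τ)) :
    conv (Con (CRecN τ) · succ n · a · f)
         (f · n · (Con (CRecN τ) · n · a · f))
| conv_recL_nil ρ τ (a : term τ) (f : term (ρ ⇒ TList ρ ⇒ τ ⇒ τ)) :
    conv (Con (CRecL ρ τ) · nil_ ρ · a · f) a
| conv_recL_cons ρ τ (x : term ρ) (l : term (TList ρ))
    (a : term τ) (f : term (ρ ⇒ TList ρ ⇒ τ ⇒ τ)) :
    conv (Con (CRecL ρ τ) · cons_ x l · a · f)
         (f · x · l · (Con (CRecL ρ τ) · l · a · f)).

Inductive system : Type := NA | MA | HA | PA.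

Definition has_bot (X : system) : bool :=
  match X with MA => true | _ => false end.

Definition has_or_ex (X : system) : bool :=
  match X with HA | PA => true | _ => false end.

Definition is_classical (X : system) : bool :=
  match X with PA => true | _ => false end.

Inductive form (X : system) : Type :=
| At (t : term TBool)
| Imp (A B : form X)
| And (A B : form X)
| All (ρ : ty) (A : form X)
| Bot (h : has_bot X = true)
| Or (h : has_or_ex X = true) (A B : form X)
| Ex (h : has_or_ex X = true) (ρ : ty) (A : form X).

Arguments At {X} t.
Arguments All {X} ρ A.
Arguments Bot {X} h.
Arguments Or {X} h A B.
Arguments Ex {X} h ρ A.

Declare Scope form_scope.
Delimit Scope form_scope with form.
Bind Scope form_scope with form.
Infix "⟶" := Imp (at level 85, right associativity) : form_scope.
Infix "⋏" := And (at level 80, right associativity) : form_scope.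
Local Open Scope form_scope.

Definition Verum {X : system} : form X := At tt.
Definition Falsum {X : system} : form X := At ff.
Definition Neg (X : system) (A : form X) : form X := A ⟶ Falsum.
Definition bot : form MA := @Bot MA eq_refl.

Fixpoint rename_form (X : system) (r : renaming) (A : form X) : form X :=
  match A with
  | At t => At (rename r t)
  | Imp A B => Imp (rename_form r A) (rename_form r B)
  | And A B => And (rename_form r A) (rename_form r B)
  | All ρ A => All ρ (rename_form (up_ren ρ r) A)
  | Bot h => Bot h
  | Or h A B => Or h (rename_form r A) (rename_form r B)
  | Ex h ρ A => Ex h ρ (rename_form (up_ren ρ r) A)
  end.

Fixpoint subst_form (X : system) (σ : substitution) (A : form X) : form X :=
  match A with
  | At t => At (subst σ t)
  | Imp A B => Imp (subst_form σ A) (subst_form σ B)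
  | And A B => And (subst_form σ A) (subst_form σ B)
  | All ρ A => All ρ (subst_form (up ρ σ) A)
  | Bot h => Bot h
  | Or h A B => Or h (subst_form σ A) (subst_form σ B)
  | Ex h ρ A => Ex h ρ (subst_form (up ρ σ) A)
  end.

Notation "A .[ s ]" := (subst_form (inst s) A)
  (at level 2, s at level 200, left associativity, format "A .[ s ]")
  : form_scope.

Definition weaken (X : system) (ρ : ty) (A : form X) : form X :=
  rename_form (shift ρ) A.

(** This is A^S.  Only its restriction to [X := MA] matters: for the other
    systems it is the identity. *)
Fixpoint subst_bot (X : system) (S : form X) (A : form X) : form X :=
  match A with
  | At t => At t
  | Imp A B => Imp (subst_bot S A) (subst_bot S B)
  | And A B => And (subst_bot S A) (subst_bot S B)
  | All ρ A => All ρ (subst_bot (weaken ρ S) A)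
  | Bot _ => S
  | Or h A B => Or h (subst_bot S A) (subst_bot S B)
  | Ex h ρ A => Ex h ρ (subst_bot (weaken ρ S) A)
  end.

Inductive conv_form (X : system) : form X -> form X -> Prop :=
| cf_at t t' : conv t t' -> conv_form (At t) (At t')
| cf_imp A A' B B' :
    conv_form A A' -> conv_form B B' -> conv_form (Imp A B) (Imp A' B')
| cf_and A A' B B' :
    conv_form A A' -> conv_form B B' -> conv_form (And A B) (And A' B')
| cf_all ρ A A' : conv_form A A' -> conv_form (All ρ A) (All ρ A')
| cf_bot h : conv_form (Bot h) (Bot h)
| cf_or h A A' B B' :
    conv_form A A' -> conv_form B B' -> conv_form (Or h A B) (Or h A' B')
| cf_ex h ρ A A' : conv_form A A' -> conv_form (Ex h ρ A) (Ex h ρ A').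

(** In the induction schemes [A] is the body of a binder for the induction
    variable, i.e. [A] stands for A(n) with n being [Var TNat 0]. *)

Definition bool_ind_ax (X : system) (A : form X) : form X :=
  All TBool (weaken TBool A.[tt] ⟶ weaken TBool A.[ff] ⟶ A).

Definition nat_step (X : system) (A : form X) : form X :=
  All TNat
    (A ⟶ subst_form
           (scons (succ (Var TNat 0)) (fun τ n => Var τ (shift TNat τ n))) A).

Definition nat_ind_ax (X : system) (A : form X) : form X :=
  All TNat (weaken TNat A.[zero] ⟶ weaken TNat (nat_step A) ⟶ A).

(** Here x is [Var ρ 0] and l is [Var (TList ρ) 0]; they do not interfere since
    [ρ] and [TList ρ] differ.  In A(l) and A(x::l) the parameters of [A] have
    to be moved past the new binders. *)
Definition list_step (X : system) (ρ : ty) (A : form X) : form X :=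
  All ρ (All (TList ρ)
    (rename_form (up_ren (TList ρ) (shift ρ)) A ⟶
     subst_form
       (scons (cons_ (Var ρ 0) (Var (TList ρ) 0))
          (fun τ n => Var τ (shift (TList ρ) τ (shift ρ τ n)))) A)).

Definition list_ind_ax (X : system) (ρ : ty) (A : form X) : form X :=
  All (TList ρ)
    (weaken (TList ρ) A.[nil_ ρ] ⟶ weaken (TList ρ) (list_step ρ A) ⟶ A).

Inductive axiom (X : system) : form X -> Prop :=
| ax_truth : axiom Verum
| ax_bool A : axiom (bool_ind_ax A)
| ax_nat A : axiom (nat_ind_ax A)
| ax_list ρ A : axiom (list_ind_ax ρ A)
| ax_bot h : axiom (Falsum ⟶ Bot h)
| ax_or_introl h A B : axiom (A ⟶ Or h A B)
| ax_or_intror h A B : axiom (B ⟶ Or h A B)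
| ax_or_elim h A B C : axiom (Or h A B ⟶ (A ⟶ C) ⟶ (B ⟶ C) ⟶ C)
| ax_ex_intro h ρ A (t : term ρ) : axiom (A.[t] ⟶ Ex h ρ A)
| ax_ex_elim h ρ A C :
    axiom (Ex h ρ A ⟶ All ρ (A ⟶ weaken ρ C) ⟶ C)
| ax_lem h A : is_classical X = true -> axiom (Or h A (Neg A)).

Inductive derivable (X : system) : list (form X) -> form X -> Prop :=
| d_ass Γ A : In A Γ -> derivable Γ A
| d_ax Γ A : axiom A -> derivable Γ A
| d_imp_intro Γ A B : derivable (A :: Γ) B -> derivable Γ (A ⟶ B)
| d_imp_elim Γ A B : derivable Γ (A ⟶ B) -> derivable Γ A -> derivable Γ B
| d_and_intro Γ A B :
    derivable Γ A -> derivable Γ B -> derivable Γ (A ⋏ B)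
| d_and_elim_l Γ A B : derivable Γ (A ⋏ B) -> derivable Γ A
| d_and_elim_r Γ A B : derivable Γ (A ⋏ B) -> derivable Γ B
| d_all_intro Γ ρ A : derivable (map (weaken ρ) Γ) A -> derivable Γ (All ρ A)
| d_all_elim Γ ρ A (t : term ρ) : derivable Γ (All ρ A) -> derivable Γ A.[t]
| d_conv Γ A B : conv_form A B -> derivable Γ A -> derivable Γ B.

Definition provable (X : system) (A : form X) : Prop := derivable [] A.

Definition consistent (X : system) : Prop := ~ provable (@Falsum X).

(** The partial μ-recursive functions of arity [n], intensionally.  In [RPrim]
    the recursion argument is the first one, and the step function takes
    (predecessor, previous value, parameters); [RMu] searches over the first
    argument. *)
Inductive recf : nat -> Type :=
| RZero n : recf n
| RSucc : recf 1
| RProj n (i : Fin.t n) : recf n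
| RComp k n (f : recf k) (g : Fin.t k -> recf n) : recf n
| RPrim n (f : recf n) (g : recf (S (S n))) : recf (S n)
| RMu n (f : recf (S n)) : recf n.

(** [computes f v y]: the program [f] halts on input [v] with output [y]. *)
Fixpoint computes (n : nat) (f : recf n) : Vector.t nat n -> nat -> Prop :=
  match f in recf n return Vector.t nat n -> nat -> Prop with
  | RZero _ => fun v y => y = 0
  | RSucc => fun v y => y = S (Vector.hd v)
  | RProj i => fun v y => y = Vector.nth v i
  | @RComp k _ f g => fun v y =>
      exists w : Vector.t nat k,
        (forall i, computes (g i) v (Vector.nth w i)) /\ computes f w y
  | RPrim f g => fun v =>
      (fix rec (m : nat) (y : nat) : Prop :=
         match m with
         | 0 => computes f (Vector.tl v) y
         | S m => exists z, rec m z /\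
             computes g
               (Vector.cons _ m _ (Vector.cons _ z _ (Vector.tl v))) y
         end) (Vector.hd v)
  | RMu f => fun v y =>
      computes f (Vector.cons _ y _ v) 0 /\
      forall m, m < y -> exists z, computes f (Vector.cons _ m _ v) (S z)
  end.

Definition code_pair (a b : nat) : nat := Cantor.to_nat (a, b).

Arguments code_pair : simpl never.

Fixpoint code_ty (τ : ty) : nat :=
  match τ with
  | TVar n => code_pair 0 n
  | TBool => code_pair 1 0
  | TNat => code_pair 2 0
  | TList τ => code_pair 3 (code_ty τ)
  | TArr τ ρ => code_pair 4 (code_pair (code_ty τ) (code_ty ρ))
  | TProd τ ρ => code_pair 5 (code_pair (code_ty τ) (code_ty ρ))
  end.

Definition code_const (τ : ty) (c : const τ) : nat :=
  match c with
  | CPair τ ρ => code_pair 0 (code_pair (code_ty τ) (code_ty ρ))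
  | CTrue => code_pair 1 0
  | CFalse => code_pair 2 0
  | CZero => code_pair 3 0
  | CSucc => code_pair 4 0
  | CNil τ => code_pair 5 (code_ty τ)
  | CCons τ => code_pair 6 (code_ty τ)
  | CSplit ρ σ τ =>
      code_pair 7
        (code_pair (code_ty ρ) (code_pair (code_ty σ) (code_ty τ)))
  | CCases τ => code_pair 8 (code_ty τ)
  | CRecN τ => code_pair 9 (code_ty τ)
  | CRecL ρ τ => code_pair 10 (code_pair (code_ty ρ) (code_ty τ))
  end.

(** The type of a term and the omitted domain of [App] are determined by the
    code (see [code_term_inj]). *)
Fixpoint code_term (τ : ty) (t : term τ) : nat :=
  match t with
  | Var τ n => code_pair 0 (code_pair (code_ty τ) n)
  | Con c => code_pair 1 (code_const c)
  | App t s => code_pair 2 (code_pair (code_term t) (code_term s))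
  | Lam ρ t => code_pair 3 (code_pair (code_ty ρ) (code_term t))
  end.

Fixpoint code_form (X : system) (A : form X) : nat :=
  match A with
  | At t => code_pair 0 (code_term t)
  | Imp A B => code_pair 1 (code_pair (code_form A) (code_form B))
  | And A B => code_pair 2 (code_pair (code_form A) (code_form B))
  | All ρ A => code_pair 3 (code_pair (code_ty ρ) (code_form A))
  | Bot _ => code_pair 4 0
  | Or _ A B => code_pair 5 (code_pair (code_form A) (code_form B))
  | Ex _ ρ A => code_pair 6 (code_pair (code_ty ρ) (code_form A))
  end.

Lemma code_pair_inj (a b c d : nat) :
  code_pair a b = code_pair c d -> a = c /\ b = d.
Proof.
  intros H; apply (Cantor.to_nat_inj (a, b) (c, d)) in H; injection H; auto.
Qed.

Lemma code_ty_inj (τ ρ : ty) : code_ty τ = code_ty ρ -> τ = ρ.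
Proof.
  revert ρ; induction τ; intros []; cbn; intros H;
    repeat match goal with
    | H : code_pair _ _ = code_pair _ _ |- _ =>
        apply code_pair_inj in H; destruct H
    end; try discriminate; f_equal; auto.
Qed.

Lemma code_const_inj (τ ρ : ty) (c : const τ) (d : const ρ) :
  code_const c = code_const d -> existT const τ c = existT const ρ d.
Proof.
  destruct c, d; cbn; intros H;
    repeat match goal with
    | H : code_pair _ _ = code_pair _ _ |- _ =>
        apply code_pair_inj in H; destruct H
    | H : code_ty _ = code_ty _ |- _ => apply code_ty_inj in H; subst
    end; try discriminate; reflexivity.
Qed.

Lemma existT_term_inj (τ : ty) (t s : term τ) :
  existT term τ t = existT term τ s -> t = s.
Proof. apply Eqdep_dec.inj_pair2_eq_dec, ty_eq_dec. Qed.

Lemma code_term_inj (τ ρ : ty) (t : term τ) (s : term ρ) :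
  code_term t = code_term s -> existT term τ t = existT term ρ s.
Proof.
  revert ρ s; induction t as [τ n|τ c|σ τ t IHt u IHu|σ τ t IHt];
    intros ? []; cbn; intros H;
    apply code_pair_inj in H; destruct H as [H0 H];
    try discriminate H0.
  - apply code_pair_inj in H; destruct H as [H ->].
    apply code_ty_inj in H; subst; reflexivity.
  - apply code_const_inj in H.
    injection H as -> H.
    apply Eqdep_dec.inj_pair2_eq_dec in H; [|apply ty_eq_dec].
    subst; reflexivity.
  - apply code_pair_inj in H; destruct H as [H1 H2].
    apply IHt in H1; apply IHu in H2.
    pose proof (f_equal (@projT1 _ _) H1) as E; cbn in E.
    injection E as -> ->.
    apply existT_term_inj in H1, H2; subst; reflexivity.
  - apply code_pair_inj in H; destruct H as [H1 H2].
    apply code_ty_inj in H1; apply IHt in H2.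
    pose proof (f_equal (@projT1 _ _) H2) as E; cbn in E; subst.
    apply existT_term_inj in H2; subst; reflexivity.
Qed.

Lemma code_form_inj (X : system) (A B : form X) :
  code_form A = code_form B -> A = B.
Proof.
  revert B; induction A; intros []; cbn; intros H;
    repeat match goal with
    | H : code_pair _ _ = code_pair _ _ |- _ =>
        apply code_pair_inj in H; destruct H
    | H : code_ty _ = code_ty _ |- _ => apply code_ty_inj in H; subst
    | H : code_term _ = code_term _ |- _ =>
        apply code_term_inj, existT_term_inj in H; subst
    | h : ?b = true, h' : ?b = true |- _ =>
        rewrite (Eqdep_dec.UIP_dec bool_dec h h') in *; clear h
    end; try discriminate; f_equal; auto.
Qed.

(** A set of formulas is decided by a recursive algorithm if some program
    answers 1 or 0 on the Gödel number of every formula according to whether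
    the formula has the property. *)
Definition recursively_decidable (X : system) (P : form X -> Prop) : Prop :=
  exists f : recf 1, forall A : form X,
    let v := Vector.cons nat (code_form A) 0 (Vector.nil nat) in
    (P A /\ computes f v 1) \/ (~ P A /\ computes f v 0).

(* Main.v *)
(** Given a program [f] claimed to decide one of the properties, self-reference
    yields a Σ1-sentence [B], free of [bot], which says that [f] rejects [Φ B],
    where [Φ B] is, for the four properties in turn, [bot ⟶ B],
    [(bot ⟶ B) ⟶ bot], [B] and [bot ⋏ Neg B].  Gödel's T has enough terms to
    evaluate [f] with bounded fuel, and closed boolean terms convert to their
    values in the full type structure over the natural numbers (a Tait-style
    argument); so [B] is provable if it is true, and then [Φ B] has the
    property.  If [B] is false, [Φ B] does not have the property: this is
    refuted in a Kripke model with two worlds and the full type structure as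
    constant domain, whose upper world forces [bot].  The lower world is needed
    for the second property only, because classically
    [A ⟶ (subst_bot Falsum A ⟶ bot) ⟶ bot] holds whatever [bot] means. *)

From Stdlib Require Import List Bool Lia FunctionalExtensionality.
From Stdlib Require Cantor Fin Vector.
Import ListNotations.
Require Import Defs.
Local Open Scope ty_scope.
Local Open Scope term_scope.
Local Open Scope form_scope.

Set Implicit Arguments.
Unset Strict Implicit.

(** * Substitution *)

Definition rcomp (r s : renaming) : renaming := fun τ n => s τ (r τ n).

Lemma up_rcomp ρ r s : rcomp (up_ren ρ r) (up_ren ρ s) = up_ren ρ (rcomp r s).
Proof.
  extensionality τ; extensionality n; unfold rcomp, up_ren.
  destruct (ty_eq_dec ρ τ); [destruct n|]; reflexivity.
Qed.

Lemma rename_rename τ (t : term τ) r s :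
  rename s (rename r t) = rename (rcomp r s) t.
Proof.
  revert r s; induction t; intros; cbn; f_equal; auto.
  now rewrite IHt, up_rcomp.
Qed.

Lemma shift_up_ren ρ r : rcomp (shift ρ) (up_ren ρ r) = rcomp r (shift ρ).
Proof.
  extensionality τ; extensionality n; unfold rcomp, up_ren, shift.
  destruct (ty_eq_dec ρ τ); reflexivity.
Qed.

Lemma scons_up_ren ρ (s : term ρ) σ r :
  (fun τ n => scons s σ τ (up_ren ρ r τ n)) = scons s (fun τ n => σ τ (r τ n)).
Proof.
  extensionality τ; extensionality n; unfold scons, up_ren.
  destruct (ty_eq_dec ρ τ); [destruct n|]; reflexivity.
Qed.

Lemma scons_map ρ (s : term ρ) σ (h : forall τ, term τ -> term τ) :
  (fun τ n => h τ (scons s σ τ n)) = scons (h ρ s) (fun τ n => h τ (σ τ n)).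
Proof.
  extensionality τ; extensionality n; unfold scons.
  destruct (ty_eq_dec ρ τ) as [e|]; [|reflexivity].
  destruct e, n; reflexivity.
Qed.

Lemma subst_rename τ (t : term τ) r σ :
  subst σ (rename r t) = subst (fun τ n => σ τ (r τ n)) t.
Proof.
  revert r σ; induction t; intros; cbn; f_equal; auto.
  rewrite IHt; unfold up at 1; now rewrite scons_up_ren.
Qed.

Lemma rename_subst τ (t : term τ) r σ :
  rename r (subst σ t) = subst (fun τ n => rename r (σ τ n)) t.
Proof.
  revert r σ; induction t; intros; cbn; f_equal; auto.
  rewrite IHt; f_equal; unfold up.
  rewrite (@scons_map _ _ _ (fun τ t => rename (up_ren ρ r) t)); f_equal.
  - cbn; unfold up_ren; now destruct (ty_eq_dec ρ ρ).
  - extensionality τ'; extensionality n.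
    now rewrite !rename_rename, shift_up_ren.
Qed.

Lemma scons_shift ρ (s : term ρ) σ :
  (fun τ n => scons s σ τ (shift ρ τ n)) = σ.
Proof.
  extensionality τ; extensionality n; unfold scons, shift.
  now destruct (ty_eq_dec ρ τ).
Qed.

Lemma subst_subst τ (t : term τ) σ θ :
  subst θ (subst σ t) = subst (fun τ n => subst θ (σ τ n)) t.
Proof.
  revert σ θ; induction t; intros; cbn; f_equal; auto.
  rewrite IHt; f_equal; unfold up at 2.
  rewrite (@scons_map _ _ _ (fun τ t => subst (up ρ θ) t)); unfold up at 3; f_equal.
  - cbn; unfold up, scons; destruct (ty_eq_dec ρ ρ) as [e|]; [|easy].
    now rewrite (Eqdep_dec.UIP_dec ty_eq_dec e eq_refl).
  - extensionality τ'; extensionality n.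
    rewrite subst_rename, rename_subst; unfold up; now rewrite scons_shift.
Qed.

Lemma up_Var ρ : up ρ Var = Var.
Proof.
  extensionality τ; extensionality n; unfold up, scons; cbn; unfold shift.
  destruct (ty_eq_dec ρ τ) as [e|]; [|reflexivity].
  destruct e, n; reflexivity.
Qed.

Lemma subst_Var τ (t : term τ) : subst Var t = t.
Proof. induction t; cbn; rewrite ?up_Var; congruence. Qed.

(** Contracting a beta-redex whose body was substituted under its binder thus yields one extended
    substitution, the shape an induction on terms can handle. *)
Lemma subst_inst_up ρ (s : term ρ) τ (t : term τ) σ :
  subst (inst s) (subst (up ρ σ) t) = subst (scons s σ) t.
Proof.
  rewrite subst_subst; f_equal; unfold up.
  rewrite (@scons_map _ _ _ (fun τ t => subst (inst s) t)); f_equal.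
  - cbn; unfold inst, scons; destruct (ty_eq_dec ρ ρ) as [e|]; [|easy].
    now rewrite (Eqdep_dec.UIP_dec ty_eq_dec e eq_refl).
  - extensionality τ'; extensionality n.
    rewrite subst_rename; unfold inst; rewrite scons_shift; apply subst_Var.
Qed.

(** Invariance replaces a count of free variables, so that [subst] disappears by rewriting. *)
Definition closed (τ : ty) (t : term τ) : Prop := forall σ, subst σ t = t.

(** * The full type structure over the natural numbers *)

Fixpoint den (τ : ty) : Type :=
  match τ with
  | TVar _ => unit
  | TBool => bool
  | TNat => nat
  | TList τ => list (den τ)
  | TArr τ ρ => den τ -> den ρ
  | TProd τ ρ => den τ * den ρ
  end.

Definition env : Type := forall τ : ty, nat -> den τ.

Definition econs (ρ : ty) (a : den ρ) (e : env) : env :=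
  fun τ n =>
    match ty_eq_dec ρ τ with
    | left E =>
        match n with 0 => eq_rect ρ den a τ E | S m => e τ m end
    | right _ => e τ n
    end.

Definition eval_const (τ : ty) (c : const τ) : den τ :=
  match c in const τ return den τ with
  | CPair _ _ => fun a b => (a, b)
  | CTrue => true
  | CFalse => false
  | CZero => 0
  | CSucc => S
  | CNil _ => []
  | CCons _ => fun x l => x :: l
  | CSplit _ _ _ => fun p f => f (fst p) (snd p)
  | CCases _ => fun b x y => if b then x else y
  | CRecN τ => fun n a f => nat_rect (fun _ => den τ) a f n
  | CRecL ρ τ => fun l a f => list_rect (fun _ => den τ) a f l
  end.

Fixpoint eval (e : env) (τ : ty) (t : term τ) : den τ :=
  match t in term τ return den τ with
  | Var τ n => e τ n
  | Con c => eval_const c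
  | App t s => eval e t (eval e s)
  | Lam ρ t => fun a => eval (econs a e) t
  end.

Definition renv (r : renaming) (e : env) : env := fun τ n => e τ (r τ n).
Definition senv (σ : substitution) (e : env) : env :=
  fun τ n => eval e (σ τ n).

Lemma renv_up ρ r (a : den ρ) e :
  renv (up_ren ρ r) (econs a e) = econs a (renv r e).
Proof.
  extensionality τ; extensionality n; unfold renv, up_ren, econs.
  destruct (ty_eq_dec ρ τ); [destruct n|]; reflexivity.
Qed.

Lemma renv_shift ρ (a : den ρ) e : renv (shift ρ) (econs a e) = e.
Proof.
  extensionality τ; extensionality n; unfold renv, shift, econs.
  destruct (ty_eq_dec ρ τ); reflexivity.
Qed.

Lemma eval_rename τ (t : term τ) r e : eval e (rename r t) = eval (renv r e) t.
Proof.
  revert r e; induction t; intros; cbn.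
  - reflexivity.
  - reflexivity.
  - now rewrite IHt1, IHt2.
  - extensionality a; now rewrite IHt, renv_up.
Qed.

Lemma senv_scons ρ (s : term ρ) σ e :
  senv (scons s σ) e = econs (eval e s) (senv σ e).
Proof.
  extensionality τ; extensionality n; unfold senv, scons, econs.
  destruct (ty_eq_dec ρ τ) as [E|]; [destruct E, n|]; reflexivity.
Qed.

Lemma senv_up ρ σ (a : den ρ) e : senv (up ρ σ) (econs a e) = econs a (senv σ e).
Proof.
  unfold up; rewrite senv_scons; f_equal.
  - cbn; unfold econs; destruct (ty_eq_dec ρ ρ) as [E|]; [|easy].
    now rewrite (Eqdep_dec.UIP_dec ty_eq_dec E eq_refl).
  - extensionality τ; extensionality n; unfold senv.
    now rewrite eval_rename, renv_shift.
Qed.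

Lemma eval_subst τ (t : term τ) σ e : eval e (subst σ t) = eval (senv σ e) t.
Proof.
  revert σ e; induction t; intros; cbn.
  - reflexivity.
  - reflexivity.
  - now rewrite IHt1, IHt2.
  - extensionality a; now rewrite IHt, senv_up.
Qed.

Lemma senv_inst ρ (s : term ρ) e : senv (inst s) e = econs (eval e s) e.
Proof. unfold inst; now rewrite senv_scons. Qed.

Lemma conv_eval τ (t s : term τ) : conv t s -> forall e, eval e t = eval e s.
Proof.
  induction 1; intros e; cbn; try reflexivity.
  - now rewrite IHconv.
  - now rewrite IHconv1.
  - now rewrite IHconv1, IHconv2.
  - extensionality a; apply IHconv.
  - now rewrite eval_subst, senv_inst.
Qed.

(** * Computability *)

Fixpoint numeral (n : nat) : term TNat :=
  match n with 0 => zero | S n => succ (numeral n) end.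

Lemma eval_numeral e n : eval e (numeral n) = n.
Proof. induction n; cbn; congruence. Qed.

Lemma closed_numeral n : closed (numeral n).
Proof. intros σ; induction n; cbn; [|rewrite IHn]; reflexivity. Qed.

(** A binary logical relation: carrying the value along turns the recursor cases into inductions on
    actual numbers and lists. Terms may be open. *)
Fixpoint computable (τ : ty) : term τ -> den τ -> Prop :=
  match τ return term τ -> den τ -> Prop with
  | TVar _ => fun _ _ => True
  | TBool => fun t b => conv t (if b then tt else ff)
  | TNat => fun t n => conv t (numeral n)
  | TList τ =>
      fix comp_list t l :=
        match l with
        | [] => conv t (nil_ τ)
        | x :: l => exists t1 t2, conv t (cons_ t1 t2) /\
                      computable t1 x /\ comp_list t2 l
        end
  | TArr τ ρ => fun t f =>
      forall s a, computable s a -> computable (App t s) (f a)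
  | TProd τ ρ => fun t p =>
      exists t1 t2, conv t (Con (CPair τ ρ) · t1 · t2) /\
        computable t1 (fst p) /\ computable t2 (snd p)
  end.

Lemma computable_conv τ (t s : term τ) a :
  conv t s -> computable s a -> computable t a.
Proof.
  revert t s a; induction τ; cbn; intros t s a H; auto.
  - now apply conv_trans.
  - now apply conv_trans.
  - destruct a; [now apply conv_trans|].
    intros (t1 & t2 & H' & Hr); exists t1, t2; split; [|exact Hr].
    now apply (conv_trans H).
  - intros Hs u b Hu; eapply IHτ2; [|exact (Hs u b Hu)].
    apply conv_app; [exact H|apply conv_refl].
  - intros (t1 & t2 & H' & Hr); exists t1, t2; split; [|exact Hr].
    now apply (conv_trans H).
Qed.

Lemma conv_app3 ρ1 ρ2 ρ3 τ (c : term (ρ1 ⇒ ρ2 ⇒ ρ3 ⇒ τ)) t t' a f :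
  conv t t' -> conv (c · t · a · f) (c · t' · a · f).
Proof. intros H; repeat apply conv_app; auto using conv_refl. Qed.

Lemma conv_app2 ρ1 ρ2 τ (c : term (ρ1 ⇒ ρ2 ⇒ τ)) t t' f :
  conv t t' -> conv (c · t · f) (c · t' · f).
Proof. intros H; repeat apply conv_app; auto using conv_refl. Qed.

Lemma computable_const τ (c : const τ) : computable (Con c) (eval_const c).
Proof.
  destruct c.
  - intros t a Ht s b Hs; exists t, s; auto using conv_refl.
  - apply conv_refl.
  - apply conv_refl.
  - apply conv_refl.
  - intros t n Ht; cbn; apply conv_app; [apply conv_refl|exact Ht].
  - apply conv_refl.
  - intros t a Ht s b Hs; exists t, s; split; [apply conv_refl|]; auto.
  - intros t p (t1 & t2 & H & H1 & H2) f f' Hf; cbn.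
    eapply computable_conv; [|exact (Hf _ _ H1 _ _ H2)].
    eapply conv_trans; [apply conv_app2, H|apply conv_split].
  - intros t b Ht s a Hs r d Hr.
    eapply computable_conv; [apply conv_app3, Ht|].
    destruct b; eapply computable_conv; eauto using conv_cases_tt, conv_cases_ff.
  - intros t n Ht a a' Ha f f' Hf.
    (* Numerals are canonical, so [t] can be replaced before the induction. *)
    eapply computable_conv; [apply conv_app3, Ht|]; clear t Ht.
    induction n as [|n IH]; cbn.
    + eapply computable_conv; [apply conv_recN_zero|exact Ha].
    + eapply computable_conv; [apply conv_recN_succ|].
      apply Hf; [apply conv_refl|exact IH].
  (* A list value has no canonical term, as its entries are arbitrary computable terms; hence [t]
     stays general in the induction. *)
  - intros t l Ht a a' Ha f f' Hf; revert t Ht.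
    induction l as [|x l IH]; intros t Ht.
    + eapply computable_conv; [apply conv_app3, Ht|].
      eapply computable_conv; [apply conv_recL_nil|exact Ha].
    + destruct Ht as (t1 & t2 & H & H1 & H2).
      eapply computable_conv; [apply conv_app3, H|].
      eapply computable_conv; [apply conv_recL_cons|].
      apply Hf; [exact H1|exact H2|exact (IH _ H2)].
Qed.

Lemma computable_scons ρ (s : term ρ) a σ e :
  computable s a -> (forall τ n, computable (σ τ n) (e τ n)) ->
  forall τ n, computable (scons s σ τ n) (econs a e τ n).
Proof.
  intros Hs H τ n; unfold scons, econs.
  destruct (ty_eq_dec ρ τ) as [E|]; [destruct E, n|]; cbn; auto.
Qed.

(** The fundamental lemma of the logical relation; a λ-abstraction is handled by closure under
    beta-expansion. *)
Lemma computable_subst τ (t : term τ) σ e :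
  (forall τ n, computable (σ τ n) (e τ n)) ->
  computable (subst σ t) (eval e t).
Proof.
  revert σ e; induction t; intros σ e H; cbn.
  - apply H.
  - apply computable_const.
  - now apply IHt1; [|apply IHt2].
  - intros s a Hs; eapply computable_conv; [apply conv_beta|].
    rewrite subst_inst_up; apply IHt, computable_scons; assumption.
Qed.

(* Substitutions are quantified over because a type variable has no closed
   inhabitant. *)
Lemma computable_inhabited (τ : ty) :
  {p : term τ * den τ | forall σ, computable (subst σ (fst p)) (snd p)}.
Proof.
  induction τ as [n| | |τ _|τ _ ρ [[t a] H]|τ [[t a] H] ρ [[s b] H']].
  - now exists (Var (TVar n) 0, Datatypes.tt).
  - exists (tt, true); intros; apply conv_refl.
  - exists (zero, 0); intros; apply conv_refl.
  - exists (nil_ τ, []); intros; apply conv_refl.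
  - exists (Lam τ t, fun _ => a); intros σ s b _; cbn.
    eapply computable_conv; [apply conv_beta|].
    rewrite subst_inst_up; apply H.
  - exists (Con (CPair τ ρ) · t · s, (a, b)); intros σ; cbn.
    eexists; eexists; split; [apply conv_refl|]; split; [apply H|apply H'].
Qed.

Definition default_env : env :=
  fun τ _ => snd (proj1_sig (computable_inhabited τ)).

(** Computability at [TBool] is conversion to the value, so the fundamental lemma suffices once some
    substitution is computable. *)
Lemma closed_conv_tt (t : term TBool) :
  closed t -> (forall e, eval e t = true) -> conv t tt.
Proof.
  intros Ht He.
  (* The outer [subst Var] brings the inhabitants into the form for which [computable_inhabited]
     asserts computability. *)
  set (σ := fun τ (_ : nat) => subst Var (fst (proj1_sig (computable_inhabited τ)))).
  assert (H : computable (subst σ t) (eval default_env t)).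
  { apply computable_subst; intros τ n.
    apply (proj2_sig (computable_inhabited τ)). }
  now rewrite Ht, He in H.
Qed.

(** * A Kripke model *)

(* There are two worlds [false] and [true], ordered by [implb]; only the upper
   one forces [bot], and everything else is interpreted in the full type
   structure.  The clauses for [Or] and [Ex] are junk: they do not occur in
   [form MA]. *)
Fixpoint forces (X : system) (w : bool) (e : env) (A : form X) : Prop :=
  match A with
  | At t => eval e t = true
  | Imp A B => forall w', implb w w' = true -> forces w' e A -> forces w' e B
  | And A B => forces w e A /\ forces w e B
  | All ρ A => forall a : den ρ, forces w (econs a e) A
  | Bot _ => w = true
  | Or _ _ _ | Ex _ _ _ => False
  end.

Lemma implb_refl w : implb w w = true.
Proof. now destruct w. Qed.

Lemma forces_mono X (A : form X) w w' e :
  implb w w' = true -> forces w e A -> forces w' e A.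
Proof.
  revert e; induction A; cbn; intros e Hw HA; auto.
  - intros w'' H; apply HA; now destruct w, w', w''.
  - destruct HA; auto.
  - now subst w; destruct w'.
Qed.

Lemma forces_rename X (A : form X) r w e :
  forces w e (rename_form r A) <-> forces w (renv r e) A.
Proof.
  revert r w e; induction A; intros r w e; cbn; try tauto.
  - now rewrite eval_rename.
  - now setoid_rewrite IHA1; setoid_rewrite IHA2.
  - now rewrite IHA1, IHA2.
  - split; intros H a; specialize (H a); [apply IHA in H|apply IHA];
      now rewrite renv_up in *.
Qed.

Lemma forces_subst X (A : form X) σ w e :
  forces w e (subst_form σ A) <-> forces w (senv σ e) A.
Proof.
  revert σ w e; induction A; intros r w e; cbn; try tauto.
  - now rewrite eval_subst.
  - now setoid_rewrite IHA1; setoid_rewrite IHA2.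
  - now rewrite IHA1, IHA2.
  - split; intros H a; specialize (H a); [apply IHA in H|apply IHA];
      now rewrite senv_up in *.
Qed.

Lemma forces_weaken X (A : form X) ρ (a : den ρ) w e :
  forces w (econs a e) (weaken ρ A) <-> forces w e A.
Proof. unfold weaken; now rewrite forces_rename, renv_shift. Qed.

Lemma forces_inst X (A : form X) ρ (s : term ρ) w e :
  forces w e A.[s] <-> forces w (econs (eval e s) e) A.
Proof. now rewrite forces_subst, senv_inst. Qed.

Lemma forces_conv X (A B : form X) w e :
  conv_form A B -> forces w e A <-> forces w e B.
Proof.
  intros H; revert w e; induction H; intros w e; cbn; try tauto.
  - now rewrite (conv_eval H).
  - now setoid_rewrite IHconv_form1; setoid_rewrite IHconv_form2.
  - now rewrite IHconv_form1, IHconv_form2.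
  - now setoid_rewrite IHconv_form.
Qed.

Lemma forces_nat_step X (A : form X) w e :
  forces w e (nat_step A) <->
  forall n w', implb w w' = true ->
    forces w' (econs (n : den TNat) e) A ->
    forces w' (econs (S n : den TNat) e) A.
Proof.
  cbn; setoid_rewrite forces_subst; setoid_rewrite senv_scons.
  assert (E : forall n : nat,
    senv (fun τ m => Var τ (shift TNat τ m)) (econs (n : den TNat) e) = e)
    by (intros n; apply (renv_shift (ρ := TNat))).
  now setoid_rewrite E.
Qed.

Lemma forces_list_step X ρ (A : form X) w e :
  forces w e (list_step ρ A) <->
  forall (x : den ρ) (l : den (TList ρ)) w', implb w w' = true ->
    forces w' (econs l e) A -> forces w' (econs (x :: l : den (TList ρ)) e) A.
Proof.
  assert (E : forall (x : den ρ) (l : den (TList ρ)),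
    senv (scons (cons_ (Var ρ 0) (Var (TList ρ) 0))
            (fun τ n => Var τ (shift (TList ρ) τ (shift ρ τ n))))
      (econs l (econs x e)) = econs (x :: l : den (TList ρ)) e).
  { intros x l; rewrite senv_scons; f_equal.
    - cbn; f_equal.
      (* The binder of the list leaves [Var ρ 0] alone, since no type is its own list type. *)
      + unfold econs; destruct (ty_eq_dec (TList ρ) ρ) as [E|_].
        { exfalso; revert E; clear; induction ρ; congruence. }
        destruct (ty_eq_dec ρ ρ) as [E|]; [|easy].
        now rewrite (Eqdep_dec.UIP_dec ty_eq_dec E eq_refl).
      + unfold econs; destruct (ty_eq_dec (TList ρ) (TList ρ)) as [E|]; [|easy].
        now rewrite (Eqdep_dec.UIP_dec ty_eq_dec E eq_refl).
    - change (renv (shift ρ) (renv (shift (TList ρ)) (econs l (econs x e))) = e).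
      now rewrite !renv_shift. }
  cbn; setoid_rewrite forces_subst; setoid_rewrite E.
  setoid_rewrite forces_rename; setoid_rewrite renv_up.
  now setoid_rewrite renv_shift.
Qed.

(** Booleans, numbers and lists are standard in the full type structure, so the induction axioms
    follow from induction outside, at a fixed world. *)
Lemma axiom_forces (A : form MA) : axiom A -> forall w e, forces w e A.
Proof.
  (* This also settles [ax_bot], because forcing [Falsum] means [false = true]; the other cases
     removed contain [has_or_ex MA = true]. *)
  destruct 1; try discriminate; intros w e.
  - reflexivity.
  - intros b w1 _ H1 w2 L2 H2.
    apply (forces_mono L2) in H1.
    apply forces_weaken, forces_inst in H1, H2; now destruct b.
  - intros n w1 _ H1 w2 L2 H2.
    apply (forces_mono L2) in H1.
    apply forces_weaken, forces_inst in H1.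
    apply forces_weaken in H2; rewrite forces_nat_step in H2.
    induction n; [exact H1|]; apply H2; [apply implb_refl|exact IHn].
  - intros l w1 _ H1 w2 L2 H2.
    apply (forces_mono L2) in H1.
    apply forces_weaken, forces_inst in H1.
    apply forces_weaken in H2; rewrite forces_list_step in H2.
    induction l; [exact H1|]; apply H2; [apply implb_refl|exact IHl].
Qed.

Lemma derivable_forces (Γ : list (form MA)) A :
  derivable Γ A ->
  forall w e, (forall C, In C Γ -> forces w e C) -> forces w e A.
Proof.
  induction 1; intros w e HΓ.
  - auto.
  - now apply axiom_forces.
  - intros w' Hw HA; apply IHderivable; intros C [<-|HC]; [exact HA|].
    apply (forces_mono Hw); auto.
  - exact (IHderivable1 w e HΓ w (implb_refl w) (IHderivable2 w e HΓ)).
  - split; auto.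
  - now apply IHderivable.
  - now apply IHderivable.
  - intros a; apply IHderivable; intros C HC.
    apply in_map_iff in HC as (D & <- & HD).
    apply forces_weaken; auto.
  - apply forces_inst; now apply IHderivable.
  - apply (forces_conv w e H); auto.
Qed.

Lemma provable_forces (A : form MA) : provable A -> forall w e, forces w e A.
Proof. intros H w e; now apply (derivable_forces H). Qed.

(** * Recursive functions as terms *)

(** Indices are counted per type: in the step term index 0 is the recursive value, so index 1 is the
    head, and in [tl_tm] likewise the tail. *)
Definition hd_tm : term (TList TNat ⇒ TNat) :=
  Lam (TList TNat)
    (Con (CRecL TNat TNat) · Var (TList TNat) 0 · zero ·
       Lam TNat (Lam (TList TNat) (Lam TNat (Var TNat 1)))).

Definition tl_tm : term (TList TNat ⇒ TList TNat) :=
  Lam (TList TNat)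
    (Con (CRecL TNat (TList TNat)) · Var (TList TNat) 0 · nil_ TNat ·
       Lam TNat (Lam (TList TNat) (Lam (TList TNat) (Var (TList TNat) 1)))).

Fixpoint nth_tm (n : nat) (i : Fin.t n) : term (TList TNat ⇒ TNat) :=
  match i with
  | Fin.F1 => hd_tm
  | Fin.FS i => Lam (TList TNat) (nth_tm i · (tl_tm · Var (TList TNat) 0))
  end.

(* A partial function with arguments in a list is approximated by a total one
    with an additional fuel argument: the value 0 means "out of fuel" and
    [S y] means "halted with output [y]". *)
Notation fuelled := (term (TNat ⇒ TList TNat ⇒ TNat)).

(* If [r] is [S z] then [h] else [a]; in [h], [z] is [Var TNat 1]. *)
Notation case_nat r a h := (Con (CRecN TNat) · r · a · Lam TNat (Lam TNat h)).

(** Continuation-passing style: the last argument receives the list of all outputs, and one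
    component out of fuel aborts the whole with 0. *)
Fixpoint seq_tm (k : nat) :
    (Fin.t k -> fuelled) ->
    term (TNat ⇒ TList TNat ⇒ (TList TNat ⇒ TNat) ⇒ TNat) :=
  match k with
  | 0 => fun _ =>
      Lam TNat (Lam (TList TNat) (Lam (TList TNat ⇒ TNat)
        (Var (TList TNat ⇒ TNat) 0 · nil_ TNat)))
  | S k => fun g =>
      Lam TNat (Lam (TList TNat) (Lam (TList TNat ⇒ TNat)
        (case_nat (g Fin.F1 · Var TNat 0 · Var (TList TNat) 0) zero
          (seq_tm (fun i => g (Fin.FS i)) · Var TNat 2 · Var (TList TNat) 0 ·
            Lam (TList TNat) (Var (TList TNat ⇒ TNat) 0 ·
              cons_ (Var TNat 1) (Var (TList TNat) 0))))))
  end.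

(** Only [RMu] consumes fuel, as the number of candidates it may test; its recursion at type
    [TNat ⇒ TNat] builds the search from a given start. Every subprogram gets the full original
    fuel. *)
Fixpoint compile (n : nat) (f : recf n) : fuelled :=
  match f with
  | RZero _ => Lam TNat (Lam (TList TNat) (succ zero))
  | RSucc =>
      Lam TNat (Lam (TList TNat) (succ (succ (hd_tm · Var (TList TNat) 0))))
  | RProj i =>
      Lam TNat (Lam (TList TNat) (succ (nth_tm i · Var (TList TNat) 0)))
  | RComp f g =>
      Lam TNat (Lam (TList TNat)
        (seq_tm (fun i => compile (g i)) · Var TNat 0 · Var (TList TNat) 0 ·
           (compile f · Var TNat 0)))
  | RPrim f g =>
      Lam TNat (Lam (TList TNat)
        (Con (CRecN TNat) · (hd_tm · Var (TList TNat) 0) ·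
          (compile f · Var TNat 0 · (tl_tm · Var (TList TNat) 0)) ·
          Lam TNat (Lam TNat
            (case_nat (Var TNat 0) zero
              (compile g · Var TNat 4 ·
                 cons_ (Var TNat 3) (cons_ (Var TNat 1)
                   (tl_tm · Var (TList TNat) 0)))))))
  | RMu f =>
      Lam TNat (Lam (TList TNat)
        (Con (CRecN (TNat ⇒ TNat)) · Var TNat 0 · Lam TNat zero ·
          Lam TNat (Lam (TNat ⇒ TNat) (Lam TNat
            (case_nat
              (compile f · Var TNat 2 ·
                 cons_ (Var TNat 0) (Var (TList TNat) 0)) zero
              (case_nat (Var TNat 1) (succ (Var TNat 2))
                (Var (TNat ⇒ TNat) 0 · succ (Var TNat 4)))))) · zero))
  end.

Lemma closed_nth_tm n (i : Fin.t n) : closed (nth_tm i).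
Proof. induction i; intros σ; [reflexivity|]; cbn; now rewrite IHi. Qed.

Lemma closed_seq_tm k (g : Fin.t k -> fuelled) :
  (forall i, closed (g i)) -> closed (seq_tm g).
Proof.
  induction k as [|k IH]; intros Hg σ; [reflexivity|].
  cbn; rewrite (Hg Fin.F1), IH; [reflexivity|auto].
Qed.

Lemma closed_compile n (f : recf n) : closed (compile f).
Proof.
  induction f as [| |n i|k n f IHf g IHg|n f IHf g IHg|n f IHf]; intros σ; cbn.
  - reflexivity.
  - reflexivity.
  - now rewrite closed_nth_tm.
  - now rewrite (closed_seq_tm IHg), IHf.
  - now rewrite IHf, IHg.
  - now rewrite IHf.
Qed.

(** Two facts in one: fuel [K] or more gives the right answer, and less fuel never gives a wrong
    one. Uniformity in [e] lets compiled terms be evaluated under binders. *)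
Definition approximates (t : fuelled) (l : list nat) (y : nat) : Prop :=
  exists K, forall e k, eval e t k l = S y \/ (k < K /\ eval e t k l = 0).

Lemma eval_nth_tm n (i : Fin.t n) (v : Vector.t nat n) e :
  eval e (nth_tm i) (Vector.to_list v) = Vector.nth v i.
Proof.
  revert v e; induction i; intros v e; rewrite (Vector.eta v); [reflexivity|].
  cbn; apply IHi.
Qed.

Lemma eval_seq_tm k (g : Fin.t k -> fuelled) l (w : Vector.t nat k) :
  (forall i, approximates (g i) l (Vector.nth w i)) ->
  exists K, forall e k c,
    eval e (seq_tm g) k l c = c (Vector.to_list w) \/
    (k < K /\ eval e (seq_tm g) k l c = 0).
Proof.
  induction k as [|k IH]; intros H.
  - exists 0; intros e m c; left.
    now rewrite (Vector.nil_spec w).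
  - rewrite (Vector.eta w) in *.
    destruct (H Fin.F1) as [K0 H0].
    destruct (IH (fun i => g (Fin.FS i)) (Vector.tl w)
                (fun i => H (Fin.FS i))) as [K1 H1].
    (* The sum serves as an upper bound of both fuel bounds. *)
    exists (K0 + K1); intros e m c; cbn.
    match goal with |- context [eval ?e (g Fin.F1)] =>
      destruct (H0 e m) as [E|[? E]] end; cbn in E |- *; rewrite E; cbn;
      [|right; split; [lia|reflexivity]].
    match goal with |- context [eval ?e (seq_tm _) ?m ?l ?c] =>
      destruct (H1 e m c) as [E'|[? E']] end; cbn in E' |- *; rewrite E'.
    + now left.
    + right; split; [lia|reflexivity].
Qed.

(** For [compile_mu]: the tests of all candidates below the result get a common fuel bound. *)
Lemma bounded_choice (Q : nat -> nat -> Prop) n :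
  (forall m K K', K <= K' -> Q m K -> Q m K') ->
  (forall m, m < n -> exists K, Q m K) ->
  exists K, forall m, m < n -> Q m K.
Proof.
  intros HQ; induction n as [|n IH]; intros H; [exists 0; lia|].
  destruct IH as [K HK]; [auto|]; destruct (H n) as [K' HK']; [lia|].
  exists (K + K'); intros m Hm.
  assert (m < n \/ m = n) as [Hm'| ->] by lia.
  - apply (HQ m K); [lia|auto].
  - apply (HQ n K'); [lia|auto].
Qed.

Lemma compile_mu n (f : recf (S n)) l y :
  approximates (compile f) (y :: l) 0 ->
  (forall m, m < y -> exists z, approximates (compile f) (m :: l) (S z)) ->
  approximates (compile (RMu f)) l y.
Proof.
  intros [K0 H0] H.
  destruct (@bounded_choice (fun m K => exists z, forall e k,
    eval e (compile f) k (m :: l) = S (S z) \/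
    (k < K /\ eval e (compile f) k (m :: l) = 0)) y) as [K1 H1].
  { intros m K K' HK [z Hz]; exists z; intros e k.
    destruct (Hz e k) as [?|[? ?]]; [auto|right; split; [lia|auto]]. }
  { intros m Hm; destruct (H m Hm) as (z & K & Hz); eauto. }
  (* Besides the fuel of the tests, the loop needs [S y] rounds, for the candidates 0 to [y]. *)
  exists (K0 + K1 + S y); intros e k; cbn.
  match goal with |- context [nat_rect _ _ ?s k] => set (step := s) end.
  (* The rounds left, [j], are separated from the fuel [k] of each test, which stays constant during
     the loop. *)
  enough (HS : forall j x, x <= y ->
    nat_rect (fun _ => nat -> nat) (fun _ => 0) step j x = S y \/
    ((k < K0 + K1 \/ j + x < S y) /\
     nat_rect (fun _ => nat -> nat) (fun _ => 0) step j x = 0)).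
  { destruct (HS k 0) as [E|[? E]]; [lia|now left|].
    right; split; [lia|exact E]. }
  induction j as [|j IH]; intros x Hx; cbn; [right; split; [lia|reflexivity]|].
  unfold step at 1 3; cbn.
  assert (x < y \/ x = y) as [Hx'| ->] by lia.
  - destruct (H1 x Hx') as [z Hz].
    match goal with |- context [eval ?e (compile f)] =>
      destruct (Hz e k) as [E|[? E]] end; cbn in E |- *; rewrite E; cbn.
    + destruct (IH (S x)) as [E'|[? E']]; [lia| |]; rewrite E'; [auto|].
      right; split; [lia|reflexivity].
    + right; split; [lia|reflexivity].
  - match goal with |- context [eval ?e (compile f)] =>
      destruct (H0 e k) as [E|[? E]] end; cbn in E |- *; rewrite E; cbn.
    + now left.
    + right; split; [lia|reflexivity].
Qed.

Lemma compile_computes n (f : recf n) v y :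
  computes f v y -> approximates (compile f) (Vector.to_list v) y.
Proof.
  revert v y; induction f as [| |n i|k n f IHf g IHg|n f IHf g IHg|n f IHf];
    intros v y.
  - intros ->; exists 0; now left.
  - intros ->; exists 0; left; now rewrite (Vector.eta v).
  - intros ->; exists 0; left; cbn; now rewrite eval_nth_tm.
  - intros (w & Hg & Hf).
    destruct (IHf _ _ Hf) as [K0 H0].
    destruct (@eval_seq_tm k (fun i => compile (g i)) (Vector.to_list v) w)
      as [K1 H1]; [auto|].
    exists (K0 + K1); intros e m; cbn.
    match goal with |- context [eval ?e (seq_tm _) ?m ?l ?c] =>
      destruct (H1 e m c) as [E|[? E]] end; cbn in E |- *; rewrite E;
      [|right; split; [lia|reflexivity]].
    match goal with |- context [eval ?e (compile f)] =>
      destruct (H0 e m) as [E'|[? E']] end; cbn in E' |- *; rewrite E'; auto.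
    right; split; [lia|reflexivity].
  - rewrite (Vector.eta v); generalize (Vector.hd v) (Vector.tl v); clear v.
    intros m v Hy.
    (* The actual environments contain the whole input list, hence [m]; abstracting them as [e] and
       [e'] keeps them out of the induction on [m]. *)
    enough (exists K, forall e e' k,
      let r := nat_rect (fun _ => nat)
        (eval e (compile f) k (Vector.to_list v))
        (fun p r => nat_rect (fun _ => nat) 0
           (fun z q =>
              eval (e' p r z q) (compile g) k (p :: z :: Vector.to_list v)) r)
        m in
      r = S y \/ (k < K /\ r = 0)) as [K HK].
    { exists K; intros e k.
      pose (E := @econs (TList TNat) (m :: Vector.to_list v) (@econs TNat k e)).
      exact (HK E (fun p r z q =>
        @econs TNat q (@econs TNat z (@econs TNat r (@econs TNat p E)))) k). }
    revert y Hy; induction m as [|m IHm]; intros y.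
    + intros Hf; destruct (IHf _ _ Hf) as [K H].
      exists K; intros e e' k; apply H.
    + intros (z & Hz & Hg).
      destruct (IHm _ Hz) as [K0 H0].
      assert (approximates (compile g) (m :: z :: Vector.to_list v) y)
        as [K1 H1] by exact (IHg _ _ Hg).
      exists (K0 + K1); intros e e' k; cbn -[Vector.to_list].
      destruct (H0 e e' k) as [E|[? E]]; rewrite E; cbn -[Vector.to_list];
        [|right; split; [lia|reflexivity]].
      match goal with |- context [eval ?e (compile g)] =>
        destruct (H1 e k) as [E'|[? E']] end;
        cbn -[Vector.to_list] in E' |- *; rewrite E'; auto.
      right; split; [lia|reflexivity].
  - intros [Hy Hm]; apply compile_mu; [exact (IHf _ _ Hy)|].
    intros m Hlt; destruct (Hm m Hlt) as [z Hz]; exists z; exact (IHf _ _ Hz).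
Qed.

(** * Diagonalization *)

Definition add_tm (a b : term TNat) : term TNat :=
  Con (CRecN TNat) · a · b · Lam TNat (Lam TNat (succ (Var TNat 0))).

Lemma eval_add_tm e a b : eval e (add_tm a b) = eval e a + eval e b.
Proof. cbn; induction (eval e a); cbn; congruence. Qed.

(** Cantor pairing: [b] plus the triangular number of [b + a]. The arguments are applied from
    outside, so substitution into them crosses no binder. *)
Definition pair_tm (a b : term TNat) : term TNat :=
  Lam TNat (Lam TNat
    (add_tm (Var TNat 0)
      (Con (CRecN TNat) · add_tm (Var TNat 0) (Var TNat 1) · zero ·
         Lam TNat (Lam TNat (succ (add_tm (Var TNat 1) (Var TNat 0))))))) · a · b.

Lemma eval_pair_tm e a b :
  eval e (pair_tm a b) = code_pair (eval e a) (eval e b).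
Proof.
  unfold pair_tm; cbn -[add_tm]; rewrite eval_add_tm; cbn -[add_tm].
  generalize (eval e a) (eval e b); clear a b; intros a b.
  rewrite eval_add_tm; cbn -[add_tm]; unfold code_pair, Cantor.to_nat.
  f_equal; induction (b + a); cbn -[add_tm]; [reflexivity|].
  now rewrite eval_add_tm; cbn -[add_tm]; rewrite IHn.
Qed.

Lemma subst_pair_tm σ a b :
  subst σ (pair_tm a b) = pair_tm (subst σ a) (subst σ b).
Proof. reflexivity. Qed.

(* Otherwise conversion starts computing Gödel numbers in unary. *)
Local Opaque code_pair pair_tm.

(** The arithmetized numeral function, needed because [some_fuel G n] contains [n] as a numeral. *)
Definition numeral_code_tm (a : term TNat) : term TNat :=
  Con (CRecN TNat) · a · numeral (code_term zero) ·
    Lam TNat (Lam TNat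
      (pair_tm (numeral 2)
        (pair_tm (numeral (code_term (Con CSucc))) (Var TNat 0)))).

Lemma eval_numeral_code_tm e a :
  eval e (numeral_code_tm a) = code_term (numeral (eval e a)).
Proof.
  cbn -[pair_tm numeral code_term].
  induction (eval e a) as [|n IH]; cbn -[pair_tm numeral code_term];
    [apply eval_numeral|].
  rewrite !eval_pair_tm; cbn -[numeral code_term pair_tm].
  now rewrite IH, !eval_numeral.
Qed.

Lemma subst_numeral_code_tm σ a :
  subst σ (numeral_code_tm a) = numeral_code_tm (subst σ a).
Proof.
  cbn -[pair_tm numeral]; now rewrite !subst_pair_tm, !closed_numeral.
Qed.

(** A Σ1-sentence with its existential quantifier in negative form, since [MA] has none; the
    negations use [Falsum], so [bot] does not occur. *)
Definition some_fuel (G : term (TNat ⇒ TNat ⇒ TBool)) (n : nat) : form MA :=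
  Neg (All TNat (Neg (At (G · Var TNat 0 · numeral n)))).

(** The diagonal function: [a] enters once as the code of the predicate and once as the number that
    the sentence mentions. The numerals 0 to 3 are constructor tags of [code_form] and
    [code_term]. *)
Definition some_fuel_code_tm (a : term TNat) : term TNat :=
  pair_tm (numeral 1) (pair_tm
    (pair_tm (numeral 3) (pair_tm (numeral (code_ty TNat))
      (pair_tm (numeral 1) (pair_tm
        (pair_tm (numeral 0) (pair_tm (numeral 2) (pair_tm
          (pair_tm (numeral 2) (pair_tm a (numeral (code_term (Var TNat 0)))))
          (numeral_code_tm a))))
        (numeral (code_form (@Falsum MA)))))))
    (numeral (code_form (@Falsum MA)))).

Lemma eval_some_fuel_code_tm
    e (a : term TNat) (G : term (TNat ⇒ TNat ⇒ TBool)) :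
  eval e a = code_term G ->
  eval e (some_fuel_code_tm a) = code_form (some_fuel G (code_term G)).
Proof.
  intros Ha; unfold some_fuel_code_tm.
  now rewrite !eval_pair_tm, eval_numeral_code_tm, !eval_numeral, !Ha.
Qed.

Lemma subst_some_fuel_code_tm σ a :
  subst σ (some_fuel_code_tm a) = some_fuel_code_tm (subst σ a).
Proof.
  unfold some_fuel_code_tm.
  now rewrite !subst_pair_tm, subst_numeral_code_tm, !closed_numeral.
Qed.

(* λ k n. does [f] halt with output 0, within fuel [k], on the code computed
   by [F] from the code of [some_fuel G n], where [n] is the code of [G]? *)
Definition halts_zero_tm (F : term TNat -> term TNat) (f : recf 1) :
    term (TNat ⇒ TNat ⇒ TBool) :=
  Lam TNat (Lam TNat
    (Con (CRecN TBool) ·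
      (compile f · Var TNat 1 ·
         cons_ (F (some_fuel_code_tm (Var TNat 0))) (nil_ TNat)) · ff ·
      Lam TNat (Lam TBool (Con (CRecN TBool) · Var TNat 0 · tt ·
        Lam TNat (Lam TBool ff))))).

Lemma closed_halts_zero_tm F f :
  (forall σ a, subst σ (F a) = F (subst σ a)) -> closed (halts_zero_tm F f).
Proof.
  intros subst_F σ; unfold halts_zero_tm; cbn -[some_fuel_code_tm].
  now rewrite closed_compile, subst_F, subst_some_fuel_code_tm.
Qed.

(** The value 1 tested for is output 0 in the fuel convention. Of the environment under the binders
    only the value of [n] matters. *)
Lemma eval_halts_zero_tm F f e k n :
  exists e' : env, e' TNat 0 = n /\
    eval e (halts_zero_tm F f) k n =
    match eval e' (compile f) k [eval e' (F (some_fuel_code_tm (Var TNat 0)))]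
    with 1 => true | _ => false end.
Proof.
  exists (@econs TNat n (@econs TNat k e)); split; [reflexivity|].
  unfold halts_zero_tm; cbn -[some_fuel_code_tm].
  match goal with |- nat_rect _ _ _ ?x = _ => destruct x as [|[|]] end;
    reflexivity.
Qed.

(** The assumed universal negation is instantiated with [numeral k], where the matrix is closed and
    true, hence converts to [tt]. *)
Lemma some_fuel_derivable Γ (G : term (TNat ⇒ TNat ⇒ TBool)) n k :
  closed G -> (forall e, eval e G k n = true) -> derivable Γ (some_fuel G n).
Proof.
  intros HG He; apply d_imp_intro.
  eapply d_imp_elim.
  - refine (d_all_elim (A := Neg _) (numeral k) _).
    apply d_ass; left; reflexivity.
  - eapply d_conv; [|apply d_ax, ax_truth].
    cbn; apply cf_at, conv_sym, closed_conv_tt; unfold inst, scons; cbn.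
    + intros σ; cbn; now rewrite !HG, !closed_numeral.
    + intros e; cbn; rewrite HG, closed_numeral, !eval_numeral; apply He.
Qed.

Lemma some_fuel_not_forced (G : term (TNat ⇒ TNat ⇒ TBool)) n w e :
  (forall e k, eval e G k n = false) -> ~ forces w e (some_fuel G n).
Proof.
  intros HG H; specialize (H w (implb_refl w)); cbn in H.
  assert (E : false = true); [|discriminate].
  apply H; intros k w' _; rewrite eval_numeral.
  now rewrite HG.
Qed.

(** The diagonal argument common to the four properties; [F] computes [Φ] on codes. Derivability of
    [B] in every context makes it usable under the assumptions of the properties. *)
Lemma undecidable (Φ : form MA -> form MA) (P : form MA -> Prop)
    (F : term TNat -> term TNat) :
  (forall σ a, subst σ (F a) = F (subst σ a)) ->
  (forall e (a : term TNat) B,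
     eval e a = code_form B -> eval e (F a) = code_form (Φ B)) ->
  (forall B, (forall Γ, derivable Γ B) -> P (Φ B)) ->
  (forall B, (forall w e, ~ forces w e B) -> ~ P (Φ B)) ->
  ~ recursively_decidable P.
Proof.
  intros HF Hcode Hyes Hno [f Hf].
  set (G := halts_zero_tm F f).
  set (B := some_fuel G (code_term G)).
  assert (HG : forall e k, exists e',
    eval e G k (code_term G) =
    match eval e' (compile f) k [code_form (Φ B)]
    with 1 => true | _ => false end).
  { intros e k.
    destruct (eval_halts_zero_tm F f e k (code_term G)) as (e' & He' & H).
    exists e'; rewrite (Hcode _ _ B) in H; [exact H|].
    now apply eval_some_fuel_code_tm. }
  destruct (Hf (Φ B)) as [[HP Hc]|[HP Hc]];
    destruct (compile_computes Hc) as [K HK].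
  (* [f] accepts [Φ B]: whatever the fuel, output 0 never appears, so [B] is forced nowhere. *)
  - revert HP; apply Hno; intros w e; apply some_fuel_not_forced.
    clear e; intros e k; destruct (HG e k) as [e' ->].
    destruct (HK e' k) as [E|[_ E]]; cbn in E |- *; now rewrite E.
  (* [f] rejects [Φ B]: fuel [K] witnesses [B], so [B] is provable and [Φ B] has the property after
     all. *)
  - apply HP, Hyes; intros Γ; apply some_fuel_derivable with (k := K).
    + now apply closed_halts_zero_tm.
    + intros e; destruct (HG e K) as [e' ->].
      destruct (HK e' K) as [E|[? _]]; [|lia].
      cbn in E |- *; now rewrite E.
Qed.

(** * Undecidability of the four properties *)

Lemma undecidable_F_imp_self :
  ~ recursively_decidable
      (fun A : form MA => provable (subst_bot Falsum A ⟶ A)).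
Proof.
  apply (@undecidable (fun B => bot ⟶ B) _
    (fun a => pair_tm (numeral 1) (pair_tm (numeral (code_form bot)) a))).
  - intros σ a; now rewrite !subst_pair_tm, !closed_numeral.
  - intros e a B Ha; now rewrite !eval_pair_tm, !eval_numeral, Ha.
  - intros B HB; do 2 apply d_imp_intro; apply HB.
  - intros B HB HP; apply (HB true default_env).
    (* The upper world forces [bot], and the premise [Falsum ⟶ subst_bot Falsum B] holds
       vacuously. *)
    refine (provable_forces HP true default_env true eq_refl _ true eq_refl eq_refl).
    intros w _; discriminate.
Qed.

Lemma undecidable_imp_double_neg_F :
  ~ recursively_decidable
      (fun A : form MA =>
         provable (A ⟶ (subst_bot Falsum A ⟶ bot) ⟶ bot)).
Proof.
  apply (@undecidable (fun B => (bot ⟶ B) ⟶ bot) _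
    (fun a => pair_tm (numeral 1) (pair_tm
       (pair_tm (numeral 1) (pair_tm (numeral (code_form bot)) a))
       (numeral (code_form bot))))).
  - intros σ a; now rewrite !subst_pair_tm, !closed_numeral.
  - intros e a B Ha; now rewrite !eval_pair_tm, !eval_numeral, Ha.
  - intros B HB; do 2 apply d_imp_intro.
    eapply d_imp_elim; [apply d_ass; right; left; reflexivity|].
    apply d_imp_intro, HB.
  - intros B HB HP; cut (false = true); [discriminate|].
    refine (provable_forces HP false default_env false eq_refl _ false eq_refl _).
    (* The upper world forces [bot] but not [B], so [bot ⟶ B] is forced at neither world. *)
    + intros w _ H; exfalso.
      exact (HB true _ (H true (implb_true_r w) eq_refl)).
    (* After substitution the inner implication has premise [Falsum] and is vacuous, so [H] would
       force [Falsum]. *)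
    + intros w _ H; exfalso; cut (false = true); [discriminate|].
      apply (H w (implb_refl w)); intros w' _; discriminate.
Qed.

Lemma undecidable_neg_F_imp_self :
  ~ recursively_decidable
      (fun A : form MA =>
         provable ((Neg (subst_bot Falsum A) ⟶ bot) ⟶ A)).
Proof.
  apply (@undecidable (fun B => B) _ (fun a => a)); [auto|auto| |].
  - intros B HB; apply d_imp_intro, HB.
  - intros B HB HP; apply (HB true default_env).
    apply (provable_forces HP true default_env true eq_refl).
    (* [implb true w] reduces to [w], so lying above the upper world is itself the forcing of
       [bot]. *)
    intros w E _; exact E.
Qed.

(** Substitution turns the first conjunct into [Falsum], so the property requires [bot ⋏ Neg B] to
    be contradictory, whereas the upper world forces it when [B] is forced nowhere. *)
Lemma undecidable_imp_F :
  ~ recursively_decidable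
      (fun A : form MA => provable (A ⟶ subst_bot Falsum A)).
Proof.
  apply (@undecidable (fun B => bot ⋏ Neg B) _
    (fun a => pair_tm (numeral 2) (pair_tm (numeral (code_form bot))
       (pair_tm (numeral 1) (pair_tm a (numeral (code_form (@Falsum MA)))))))).
  - intros σ a; now rewrite !subst_pair_tm, !closed_numeral.
  - intros e a B Ha; now rewrite !eval_pair_tm, !eval_numeral, Ha.
  - intros B HB; apply d_imp_intro.
    (* The prefix [Γ] allows for the extra assumption in the proof of the second conjunct. *)
    assert (HF : forall Γ, derivable (Γ ++ [bot ⋏ Neg B]) Falsum).
    { intros Γ; eapply d_imp_elim; [|apply HB].
      eapply d_and_elim_r, d_ass, in_or_app; right; left; reflexivity. }
    apply d_and_intro; [apply (HF [])|].
    apply d_imp_intro, (HF [_]).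
  - intros B HB HP; cut (false = true); [discriminate|].
    refine (proj1 (provable_forces HP true default_env true eq_refl _)).
    split; [reflexivity|]; intros w _ H; now apply HB in H.
Qed.

Theorem proposition3p7 :
  consistent PA ->
  ~ recursively_decidable
      (fun A : form MA => provable (subst_bot Falsum A ⟶ A)) /\
  ~ recursively_decidable
      (fun A : form MA =>
         provable (A ⟶ (subst_bot Falsum A ⟶ bot) ⟶ bot)) /\
  ~ recursively_decidable
      (fun A : form MA =>
         provable ((Neg (subst_bot Falsum A) ⟶ bot) ⟶ A)) /\
  ~ recursively_decidable
      (fun A : form MA => provable (A ⟶ subst_bot Falsum A)).
Proof.
  intros _; repeat split.
  - exact undecidable_F_imp_self.
  - exact undecidable_imp_double_neg_F.
  - exact undecidable_neg_F_imp_self.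
  - exact undecidable_imp_F.
Qed.
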